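(* Let $G$ be a non-free Artin group of almost large type, and let $\mathcal X$ be the Huang–Osajda systolic complex for $G$. Let $M$ be the maximum of those $m_{ij}$ ($i\neq j$) that are finite. If $\sigma_0,\dots,\sigma_n$ is a directed geodesic in $\mathcal X$, then there is a vertex $v_n$ of $\mathcal X$ such that $\sigma_0,\dots,\sigma_{n-1},v_n$ is a directed geodesic and such that, furthermore, if $v_n$ is an interior vertex, then there is a directed geodesic $$\sigma_0,\dots,\sigma_{n-1},v_n,v_{n+1},\dots,v_{n+k}$$ with $v_{n+1},\dots,v_{n+k}$ vertices of $\mathcal X$, $v_{n+k}$ real and $k\le M-2$.
   Context: **Directed geodesics.** $\mathcal X_\sigma$ denotes the link of a simplex $\sigma$. For a subcomplex $\mathcal Y$ and a simplex $\sigma$ of $\mathcal Y$, $\mathrm{Res}(\sigma,\mathcal Y)$ is the union of all closed simplices of $\mathcal Y$ containing $\sigma$, and $B_1(\sigma,\mathcal Y)$ is the union of all closed simplices of $\mathcal Y$ that meet $\sigma$. A sequence of simplices $\sigma_0,\dots,\sigma_n$ of $\mathcal X$ is a directed geodesic if (1) for $0\le i\le n-1$, $\sigma_i,\sigma_{i+1}$ are disjoint and span a simplex of $\mathcal X$, and (2) for $0\le i\le n-2$, $\mathrm{Res}(\sigma_i,\mathcal X_{\sigma_{i+1}})\cap B_1(\sigma_{i+2},\mathcal X_{\sigma_{i+1}})=\emptyset$. **Artin groups.** Let $(m_{ij})$ be a Coxeter matrix: a symmetric matrix with $m_{ii}=1$ and $m_{ij}\in\{2,3,\dots\}\cup\{\infty\}$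 for $i\ne j$. For $m\in\mathbb N$ let ${}_m(a,a')$ be the alternating word of length $m$ in $a,a'$ starting with $a$. The Artin group is the group $G$ with generators $X=\{a_1,a_2,\dots\}$ (finitely many, one for each row of the matrix) and relations ${}_{m_{ij}}(a_i,a_j)={}_{m_{ij}}(a_j,a_i)$ for $i\ne j$, $m_{ij}<\infty$. Its Coxeter diagram has one node for each generator and an edge labelled $m_{ij}$ joining each pair $i\ne j$. $G$ has almost large type if (1) in any triangle of edges of the diagram either at least one edge is labelled $\infty$ or no edge has label 2, and (2) in any square (4-cycle) of edges either at least one edge is labelled $\infty$ or at most one edge has label 2. For $m_{ij}<\infty$, let $G_{ij}=\langle a_i,a_j\rangle$ and let $\Delta_{ij}$ be the element represented by ${}_{m_{ij}}(a_i,a_j)$. **The Huang–Osajda complex $\mathcal X$.** Let $\mathcal G$ be the (undirected) Cayley graph of $G$ over $X$: vertex set $G$, edges $\{g,ga_i\}$; $G$ acts by left multiplication. For each pair $i\neq j$ with $m=m_{ij}<\infty$ and each $g\in G$ there is a precell: the $2m$-cycle in $\mathcal G$ formed by its two half boundaries, the paths $p_0=g,p_1,\dots,p_m=g\Delta_{ij}$ labelled ${}_m(a_i,a_j)$ and $q_0=g,q_1,\dots,q_m=g\Delta_{ij}$ labelled ${}_m(a_j,a_i)$; $g$ is its initial vertex and $g\Delta_{ij}$ its terminal vertex. Each precell is triangulated: if $m=2$, by adding the edge $\{p_0,p_2\}$; if $m\ge3$, by adding $m-2$ new vertices $o_1,\dots,o_{m-2}$ and the edges $\{p_0,o_1\}$,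 $\{o_{m-2},p_m\}$, $\{o_s,o_{s+1}\}$ $(1\le s\le m-3)$, and $\{o_s,p_s\},\{o_s,p_{s+1}\},\{o_s,q_s\},\{o_s,q_{s+1}\}$ $(1\le s\le m-2)$. The added vertices are called interior vertices; the elements of $G$ are called real vertices. Next, whenever two distinct precells $\Pi,\Pi'$ for the same pair $\{i,j\}$ have boundaries meeting in a path with $l\ge2$ edges (this path is then a proper suffix of a half boundary of one, say $\Pi$, and a proper prefix of a half boundary of the other, $\Pi'$), then, writing $o_1,\dots,o_{m-2}$ and $o'_1,\dots,o'_{m-2}$ for the interior vertices of $\Pi$ and $\Pi'$ respectively, each list numbered in order from the initial vertex to the terminal vertex of its precell (so $o_1$ is adjacent to the initial vertex of $\Pi$ and $o_{m-2}$ to its terminal vertex, and likewise for $o'_1$, $o'_{m-2}$ and $\Pi'$), and $d_s=o_{m-1-l+s}$, $d'_s=o'_s$ for $1\le s\le l-1$, one adds the edges $\{d_s,d'_s\}$ $(1\le s\le l-1)$ and $\{d'_s,d_{s+1}\}$ $(1\le s\le l-2)$. The complex $\mathcal X_{ij}$ is the flag simplicial complex whose 1-skeleton is the graph obtained in this way from the Cayley graph of $G_{ij}$ (using the precells with $g\in G_{ij}$). The complex $\mathcal X$ is the union of $\mathcal G$ and all translates $h\mathcal X_{ij}$ ($h\in G$, $m_{ij}<\infty$), one for each coset $hG_{ij}$, distinct translates being glued only along their common part in $\mathcal G$. $G$ acts on $\mathcal X$, extending its action on $\mathcal G$, with trivial simplex stabilisers, and $\mathcal X$ is systolic. *)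

(* Defs.v *)
From HB Require Import structures.
From mathcomp Require Import all_boot all_algebra.
From mathcomp Require Import boolp classical_sets cardinality.

Set Implicit Arguments.
Unset Strict Implicit.
Unset Printing Implicit Defensive.

Local Open Scope group_scope.
Local Open Scope classical_set_scope.

(* [(x, true)] is the letter x and [(x, false)] is its formal inverse. *)
Definition word (X : Type) := seq (X * bool).

Definition word_inv (X : Type) (w : word X) : word X :=
  rev [seq (l.1, ~~ l.2) | l <- w].

Section Presentation.
Variables (X : choiceType) (rels : word X -> word X -> Prop).

Inductive pres_eq : word X -> word X -> Prop :=
| pres_refl u : pres_eq u u
| pres_sym u v : pres_eq u v -> pres_eq v u
| pres_trans u v w : pres_eq u v -> pres_eq v w -> pres_eq u w
| pres_cat u u' v v' :
    pres_eq u u' -> pres_eq v v' -> pres_eq (u ++ v) (u' ++ v')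
| pres_cancel x b : pres_eq [:: (x, b); (x, ~~ b)] [::]
| pres_rel u v : rels u v -> pres_eq u v.

Definition pres_eqb (u v : word X) : bool := `[< pres_eq u v >].

Lemma pres_eqb_refl : reflexive pres_eqb.
Proof. by move=> u; apply/asboolP/pres_refl. Qed.

Lemma pres_eqb_sym : symmetric pres_eqb.
Proof. by move=> u v; apply/asboolP/asboolP; exact: pres_sym. Qed.

Lemma pres_eqb_trans : transitive pres_eqb.
Proof.
move=> v u w /asboolP uv /asboolP vw.
by apply/asboolP; apply: pres_trans uv vw.
Qed.

Canonical pres_equiv := EquivRel pres_eqb pres_eqb_refl pres_eqb_sym pres_eqb_trans.

Definition presented_group := {eq_quot pres_equiv}%qT.

HB.instance Definition _ := Choice.on presented_group.

Definition pres_class (w : word X) : presented_group :=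
  (\pi_({eq_quot pres_equiv}) w)%qT.

Lemma pres_classP u v : pres_class u = pres_class v <-> pres_eq u v.
Proof. by split=> [/eqquotP /asboolP|h] //; apply/eqquotP/asboolP. Qed.

Lemma pres_class_repr (x : presented_group) : pres_class (repr x) = x.
Proof. exact: reprK. Qed.

Lemma pres_repr_class w : pres_eq (repr (pres_class w)) w.
Proof. by apply/pres_classP; rewrite pres_class_repr. Qed.

Lemma word_inv_cat (u v : word X) :
  word_inv (u ++ v) = word_inv v ++ word_inv u.
Proof. by rewrite /word_inv map_cat rev_cat. Qed.

Lemma word_invK : involutive (@word_inv X).
Proof.
move=> w; rewrite /word_inv map_rev revK -map_comp -[RHS]map_id.
by apply: eq_map => -[x b] /=; rewrite negbK.
Qed.

Lemma pres_mulwV (w : word X) : pres_eq (w ++ word_inv w) [::].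
Proof.
elim: w => [|[x b] w IH]; first exact: pres_refl.
rewrite /word_inv /= rev_cons -cats1 -cat_cons.
rewrite -[_ :: w]cat1s -catA [w ++ _]catA.
apply: (pres_trans (v := [:: (x, b)] ++ ([::] ++ [:: (x, ~~ b)]))).
  by apply/pres_cat/pres_cat/pres_refl; [exact: pres_refl|exact: IH].
exact: pres_cancel.
Qed.

Lemma pres_mulVw (w : word X) : pres_eq (word_inv w ++ w) [::].
Proof. by have := pres_mulwV (word_inv w); rewrite word_invK. Qed.

Lemma pres_inv (u v : word X) : pres_eq u v -> pres_eq (word_inv u) (word_inv v).
Proof.
move=> uv.
have h1 : pres_eq (word_inv u) (word_inv u ++ (v ++ word_inv v)).
  rewrite -{1}[word_inv u]cats0; apply: pres_cat; first exact: pres_refl.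
  exact/pres_sym/pres_mulwV.
apply: (pres_trans h1); rewrite catA -[word_inv v in X in pres_eq _ X]cat0s.
apply: pres_cat; last exact: pres_refl.
apply: pres_trans (pres_mulVw u).
by apply: pres_cat; [exact: pres_refl|exact: pres_sym].
Qed.

Definition pres_one : presented_group := pres_class [::].
Definition pres_mul (x y : presented_group) : presented_group :=
  pres_class (repr x ++ repr y).
Definition pres_invg (x : presented_group) : presented_group :=
  pres_class (word_inv (repr x)).

Lemma pres_mulE u v :
  pres_mul (pres_class u) (pres_class v) = pres_class (u ++ v).
Proof. by apply/pres_classP/pres_cat; exact: pres_repr_class. Qed.

Lemma pres_invE u : pres_invg (pres_class u) = pres_class (word_inv u).
Proof. exact/pres_classP/pres_inv/pres_repr_class. Qed.

Lemma pres_mulA : associative pres_mul.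
Proof.
move=> x y z; rewrite -[x]pres_class_repr -[y]pres_class_repr.
by rewrite -[z]pres_class_repr !pres_mulE catA.
Qed.

Lemma pres_mul1 : left_id pres_one pres_mul.
Proof. by move=> x; rewrite -[x]pres_class_repr pres_mulE. Qed.

Lemma pres_mulr1 : right_id pres_one pres_mul.
Proof. by move=> x; rewrite -[x]pres_class_repr pres_mulE cats0. Qed.

Lemma pres_mulV : left_inverse pres_one pres_invg pres_mul.
Proof.
move=> x; rewrite -[x]pres_class_repr pres_invE pres_mulE.
exact/pres_classP/pres_mulVw.
Qed.

Lemma pres_mulrV : right_inverse pres_one pres_invg pres_mul.
Proof.
move=> x; rewrite -[x]pres_class_repr pres_invE pres_mulE.
exact/pres_classP/pres_mulwV.
Qed.

HB.instance Definition _ :=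
  isGroup.Build presented_group pres_mulA pres_mul1 pres_mulr1 pres_mulV
    pres_mulrV.

End Presentation.

Definition is_subgroup (G : groupType) (H : set G) : Prop :=
  [/\ H 1, forall x y, H x -> H y -> H (x * y) & forall x, H x -> H x^-1].

Definition subgroup_gen (G : groupType) (A : set G) : set G :=
  smallest (@is_subgroup G) A.

Definition is_free_on (G : groupType) (B : set G) : Prop :=
  forall (H : groupType) (f : G -> H),
    (exists phi : G -> H, {morph phi : x y / x * y} /\
                          (forall b, B b -> phi b = f b)) /\
    (forall phi psi : G -> H,
       {morph phi : x y / x * y} -> {morph psi : x y / x * y} ->
       (forall b, B b -> phi b = f b) -> (forall b, B b -> psi b = f b) ->
       phi =1 psi).

Definition is_free (G : groupType) : Prop := exists B : set G, is_free_on B.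

(* [None] stands for the entry infinity. *)
Definition coxeter_matrix (r : nat) (m : 'M[option nat]_r) : Prop :=
  [/\ forall i j, m i j = m j i,
      forall i, m i i = Some 1%N &
      forall i j k, i != j -> m i j = Some k -> (2 <= k)%N].

(* The Coxeter diagram is the complete graph on 'I_r, the edge {i, j} being
   labelled by m i j. *)
Definition almost_large (r : nat) (m : 'M[option nat]_r) : Prop :=
  (forall i j k : 'I_r, uniq [:: i; j; k] ->
     let edges := [:: m i j; m j k; m k i] in
     None \in edges \/ Some 2 \notin edges) /\
  (forall i j k l : 'I_r, uniq [:: i; j; k; l] ->
     let edges := [:: m i j; m j k; m k l; m l i] in
     None \in edges \/ (count_mem (Some 2) edges <= 1)%N).

Fixpoint alt (X : Type) (k : nat) (a a' : X) : seq X :=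
  if k is k'.+1 then a :: alt k' a' a else [::].

Definition alt_word (X : Type) (k : nat) (a a' : X) : word X :=
  [seq (x, true) | x <- alt k a a'].

Inductive artin_rel (r : nat) (m : 'M[option nat]_r) :
    word 'I_r -> word 'I_r -> Prop :=
| ArtinRel i j k : i != j -> m i j = Some k ->
    artin_rel m (alt_word k i j) (alt_word k j i).

Definition artin (r : nat) (m : 'M[option nat]_r) : groupType :=
  presented_group (artin_rel m).

Definition artin_gen (r : nat) (m : 'M[option nat]_r) (i : 'I_r) : artin m :=
  pres_class (artin_rel m) [:: (i, true)].

Definition max_label (r : nat) (m : 'M[option nat]_r) : nat :=
  \max_(i < r) \max_(j < r | i != j) odflt 0 (m i j).

(* A simplicial complex with vertices in V is given by the set of its
   (nonempty) simplices, each simplex being the set of its vertices. *)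
Section Complexes.
Variable V : Type.
Implicit Types (K Y : set (set V)) (s t u : set V).

Definition flag_complex (P : set V) (E : V -> V -> Prop) : set (set V) :=
  [set s | [/\ finite_set s, s !=set0, s `<=` P &
     forall v w, s v -> s w -> v <> w -> E v w \/ E w v]].

Definition link K s : set (set V) :=
  [set t | [/\ K t, t `&` s = set0 & K (t `|` s)]].

Definition Res s Y : set (set V) :=
  [set t | Y t /\ exists u, [/\ Y u, s `<=` u & t `<=` u]].

Definition B1 s Y : set (set V) :=
  [set t | Y t /\ exists u, [/\ Y u, u `&` s !=set0 & t `<=` u]].

Definition directed_geodesic K (c : seq (set V)) : Prop :=
  [/\ forall p, (p < size c)%N -> K (nth set0 c p),
      forall p, (p.+1 < size c)%N ->
        nth set0 c p `&` nth set0 c p.+1 = set0 /\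
        K (nth set0 c p `|` nth set0 c p.+1) &
      forall p, (p.+2 < size c)%N ->
        let L := link K (nth set0 c p.+1) in
        Res (nth set0 c p) L `&` B1 (nth set0 c p.+2) L = set0].

End Complexes.

Section HuangOsajda.
Variables (r : nat) (m : 'M[option nat]_r).
Notation G := (artin m).
Notation a := (artin_gen m).

(* An unordered pair {i, j} is encoded by its ordering i < j.  [Inner i j g s]
   is the interior vertex o_s of the precell for {i, j} with initial vertex g;
   it belongs to the complex only when i < j, m i j = Some k and
   1 <= s <= k - 2. *)
Inductive ho_vertex : Type :=
| Real of G
| Inner of 'I_r & 'I_r & G & nat.

Definition is_real (v : ho_vertex) : Prop := exists g, v = Real g.

Definition is_interior (v : ho_vertex) : Prop :=
  exists i j g s, v = Inner i j g s.

Definition ho_act (h : G) (v : ho_vertex) : ho_vertex :=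
  match v with
  | Real g => Real (h * g)
  | Inner i j g s => Inner i j (h * g) s
  end.

Definition cayley_complex : set (set ho_vertex) :=
  [set s | (exists g, s = [set Real g]) \/
           (exists g i, s = [set Real g; Real (g * a i)])].

Section Dihedral.
(* k is the label m i j. *)
Variables (i j : 'I_r) (k : nat).

Definition Gij : set G := subgroup_gen [set a i; a j].

(* The vertices p_t of the half boundary labelled by the alternating word
   starting with a_i (for [b = true]), and the vertices q_t of the other
   one (for [b = false]). *)
Definition half_bd (b : bool) (g : G) (t : nat) : G :=
  g * \prod_(x <- if b then alt t i j else alt t j i) a x.

Definition bd_vertices (g : G) : set G :=
  [set x | exists b t, (t <= k)%N /\ x = half_bd b g t].

Definition bd_edges (g : G) : set (set G) :=
  [set e | exists b t, (t < k)%N /\ e = [set half_bd b g t; half_bd b g t.+1]].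

(* The intersection, as subgraphs of the Cayley graph, of the boundaries of the
   precells at g and g' is a path with l edges, which is a proper suffix of a
   half boundary of the first precell and a proper prefix of one of the
   second. *)
Definition meet_in_path (g g' : G) (l : nat) : Prop :=
  (2 <= l < k)%N /\
  exists b b',
    [/\ forall t, (t <= l)%N -> half_bd b g (k - l + t) = half_bd b' g' t,
        bd_vertices g `&` bd_vertices g' =
          [set x | exists t, (t <= l)%N /\ x = half_bd b' g' t] &
        bd_edges g `&` bd_edges g' =
          [set e | exists t, (t < l)%N /\
                     e = [set half_bd b' g' t; half_bd b' g' t.+1]]].

Notation o := (Inner i j).

(* The edges of the 1-skeleton of X_ij, each in one orientation. *)
Inductive dihedral_edge : ho_vertex -> ho_vertex -> Prop :=
| edge_cayley g x : Gij g -> x = i \/ x = j ->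
    dihedral_edge (Real g) (Real (g * a x))
| edge_square g : Gij g -> k = 2 ->
    dihedral_edge (Real (half_bd true g 0)) (Real (half_bd true g 2))
| edge_initial g : Gij g -> (3 <= k)%N ->
    dihedral_edge (Real (half_bd true g 0)) (o g 1%N)
| edge_terminal g : Gij g -> (3 <= k)%N ->
    dihedral_edge (o g (k - 2)) (Real (half_bd true g k))
| edge_inner g s : Gij g -> (1 <= s <= k - 3)%N ->
    dihedral_edge (o g s) (o g s.+1)
| edge_half g s b : Gij g -> (1 <= s <= k - 2)%N ->
    dihedral_edge (o g s) (Real (half_bd b g s))
| edge_half_succ g s b : Gij g -> (1 <= s <= k - 2)%N ->
    dihedral_edge (o g s) (Real (half_bd b g s.+1))
| edge_cross g g' l s : Gij g -> Gij g' -> meet_in_path g g' l ->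
    (1 <= s <= l - 1)%N ->
    dihedral_edge (o g (k - 1 - l + s)) (o g' s)
| edge_cross_succ g g' l s : Gij g -> Gij g' -> meet_in_path g g' l ->
    (1 <= s <= l - 2)%N ->
    dihedral_edge (o g' s) (o g (k - 1 - l + s.+1)).

Definition dihedral_vertices : set ho_vertex :=
  [set v | (exists2 g, Gij g & v = Real g) \/
           (exists g s, [/\ Gij g, (1 <= s <= k - 2)%N & v = o g s])].

Definition dihedral_complex : set (set ho_vertex) :=
  flag_complex dihedral_vertices dihedral_edge.

End Dihedral.

(* The translates automatically share their common real vertices; translates
   by elements of the same coset of G_ij coincide. *)
Definition ho_complex : set (set ho_vertex) :=
  cayley_complex `|`
  [set s | exists (i j : 'I_r) k h t,
     [/\ (i < j)%N, m i j = Some k, dihedral_complex i j k t &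
         s = ho_act h @` t]].

End HuangOsajda.

Arguments Gij {r} m i j _ : assert.
Arguments cayley_complex {r} m _ : assert.
Arguments dihedral_vertices {r} m i j k _ : assert.
Arguments dihedral_complex {r} m i j k _ : assert.
Arguments ho_complex {r} m _ : assert.

(* Main.v *)
Require Import Defs.
From HB Require Import structures.
From mathcomp Require Import all_boot all_algebra.
From mathcomp Require Import boolp classical_sets cardinality.
From mathcomp Require Import all_field ring zify.

Set Implicit Arguments.
Unset Strict Implicit.
Unset Printing Implicit Defensive.

(* Any vertex v of sigma_n can serve as v_n.  Suppose v = o_s is interior to a
   precell and let t be a vertex of sigma_{n-1}; then t is a neighbour of o_s.
   The neighbours of o_s are its two neighbours o_{s-1}, o_{s+1} on the axis of
   the precell (prolonged by the initial and terminal vertices), and two classes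
   attached to the two half boundaries.  Comparing heights, i.e. values of the
   homomorphism G -> Z sending every generator to 1, shows that o_{s-1} and
   o_{s+1} have no common neighbour in the link of o_s; so if t is one of them,
   one can run along the axis in the other direction until a real vertex is
   reached.  Vertices of opposite classes are never adjacent, as otherwise the
   half boundaries of some precell would meet away from their ends, which is
   impossible already in the Coxeter group.  So if t lies on one side, one of the
   two real neighbours of o_s on the other side is a possible next vertex: one
   fails only if t is adjacent to o_{s+1}, the other only if t is adjacent to
   o_{s-1}, and these exclude each other. *)

Import GRing.Theory Num.Theory.

(** * The two halves of a precell meet only at their ends *)

Section NumbersGame.
Local Open Scope ring_scope.
Variables (r : nat) (m : 'M[option nat]_r).
Hypothesis m_coxeter : coxeter_matrix m.

(* The order is [2 k], so that [zeta k + (zeta k)^-1] plays the role of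
   2 cos (pi / k). *)
Definition zeta (k : nat) : algC :=
  sval (C_prim_root_exists (ltn0Sn (k.*2).-1)).

Lemma zeta_prim k : (0 < k)%N -> (k.*2).-primitive_root (zeta k).
Proof.
rewrite /zeta => k0; case: C_prim_root_exists => z /=.
by rewrite prednK // double_gt0.
Qed.

Lemma zeta_neq0 k : (0 < k)%N -> zeta k != 0.
Proof.
by move=> k0; rewrite (prim_root_eq0 (zeta_prim k0)); lia.
Qed.

(** The order [2 k] does not divide [2 t]. It follows that [z ^+ t - z ^- t], the analogue of sin
    (pi t / k), does not vanish. *)
Lemma zeta_exp_neq1 k t : (0 < t < k)%N -> zeta k ^+ t * zeta k ^+ t != 1.
Proof.
move=> tk; rewrite -exprD addnn -(prim_order_dvd (zeta_prim _)); last lia.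
by apply/negP => /dvdn_leq; lia.
Qed.

Lemma zeta_exp k : (0 < k)%N -> zeta k ^+ k = -1.
Proof.
move=> k0; have /eqP := prim_expr_order (zeta_prim k0).
rewrite -addnn exprD -expr2 sqrf_eq1 => /orP[|/eqP//].
by rewrite -(prim_order_dvd (zeta_prim k0)) => /dvdn_leq; lia.
Qed.

(** An infinite label imposes no relation, so its coefficient may be chosen freely. *)
Definition coef (i j : 'I_r) : algC :=
  if m i j is Some k then zeta k + (zeta k)^-1 else 0.

(* Mozes' numbers game, i.e. the dual of the geometric representation of the
   Coxeter group: [f l] is the value of a linear form on the l-th simple root. *)
Definition fire (i : 'I_r) (f : 'I_r -> algC) : 'I_r -> algC :=
  fun l => if l == i then - f i else f l + coef i l * f i.

(** The sign of a letter is dropped because [fire i] is its own inverse: words act through the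
    Coxeter group. *)
Definition play (w : word 'I_r) (f : 'I_r -> algC) : 'I_r -> algC :=
  foldl (fun f x => fire x.1 f) f w.

Lemma coefC i j : coef i j = coef j i.
Proof. by case: m_coxeter => sym _ _; rewrite /coef sym. Qed.

Lemma fireK i : involutive (fire i).
Proof.
move=> f; apply: funext => l; rewrite /fire eqxx.
case: eqP => [->|_]; ring.
Qed.

(** After division by [z - z^-1] the coefficients are the quantum integers [t-1], [t], [t+1], the
    analogues of sin (pi t / k) / sin (pi / k). For [t > 0], [if odd t then i else j] is the letter
    fired last. The induction fires the first letter and exchanges [i] and [j]. *)
Lemma play_alt i j k t f : i != j -> m i j = Some k -> (1 < k)%N ->
  let z := zeta k in
  let g := play (alt_word t i j) f in
  (z - z^-1) * g (if odd t then i else j) =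
    - (f i * (z ^+ t - z ^- t) + f j * (z ^+ t / z - z / z ^+ t)) /\
  (z - z^-1) * g (if odd t then j else i) =
    f i * (z ^+ t * z - (z ^+ t * z)^-1) + f j * (z ^+ t - z ^- t).
Proof.
move=> ij mij k1 z; have z0 : z != 0 by apply: zeta_neq0; lia.
elim: t i j f ij mij => [|t IH] i j f ij mij g.
  by rewrite /g /= expr0 invr1; split; field.
have ji : j != i by rewrite eq_sym.
have mji : m j i = Some k by case: m_coxeter => <-.
have [] := IH j i (fire i f) ji mji.
have -> : play (alt_word t j i) (fire i f) = g by [].
have -> : fire i f i = - f i by rewrite /fire eqxx.
have -> : fire i f j = f j + (z + z^-1) * f i.
  by rewrite /fire (negbTE ji) /coef mij.
have zt0 : z ^+ t != 0 by rewrite expf_neq0.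
rewrite /= if_neg if_neg exprS; move: (z ^+ t) zt0 => y y0.
move=> -> ->; split; field; exact/andP.
Qed.

(* The coefficients exist because the Cartan matrix of the pair {i, j} is
   invertible; hence firing i and j in any order changes the coordinate [l] by
   an amount determined by the final coordinates [i] and [j]. *)
Lemma fire_invariant i j k l : i != j -> m i j = Some k -> (1 < k)%N ->
  l != i -> l != j ->
  exists al be, forall f,
    let I g := g l + al * g i + be * g j : algC in
    I (fire i f) = I f /\ I (fire j f) = I f.
Proof.
move=> ij mij k1 li lj.
set z := zeta k; have z0 : z != 0 by apply: zeta_neq0; lia.
have zz : z * z - 1 != 0.
  by rewrite subr_eq0; have := @zeta_exp_neq1 k 1; rewrite expr1 => ->.
set c := z + z^-1; pose d := 4 - c ^+ 2.
have d0 : d != 0.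
  have -> : d = - ((z * z - 1) / z) ^+ 2 by rewrite /d /c; field.
  by rewrite oppr_eq0 expf_neq0 // mulf_neq0 ?invr_neq0.
exists ((2 * coef i l + c * coef j l) / d), ((2 * coef j l + c * coef i l) / d).
have cij : coef i j = c by rewrite /coef mij.
have cji : coef j i = c by rewrite coefC.
move=> f; rewrite /fire !eqxx (negbTE li) (negbTE lj) (negbTE ij).
rewrite eq_sym (negbTE ij) cij cji; rewrite /d in d0 *.
by split; field.
Qed.

Lemma play_invariant i j k l : i != j -> m i j = Some k -> (1 < k)%N ->
  l != i -> l != j ->
  exists al be, forall f t,
    let I g := g l + al * g i + be * g j : algC in
    I (play (alt_word t i j) f) = I f /\ I (play (alt_word t j i) f) = I f.
Proof.
move=> ij mij k1 li lj.
have [al [be inv]] := fire_invariant ij mij k1 li lj.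
exists al, be => f t; elim: t f => [|t IH] f //=.
have [ii jj] := inv f; have [+ _] := IH (fire j f); have [_ +] := IH (fire i f).
by rewrite /play /= ii jj.
Qed.

(** As [z ^+ k = -1], each of the two words negates the coordinates [i] and [j], and swaps them if
    [k] is odd. The invariants then determine every other coordinate. *)
Lemma play_braid i j k : i != j -> m i j = Some k ->
  play (alt_word k i j) =1 play (alt_word k j i).
Proof.
move=> ij mij f.
have k1 : (1 < k)%N by case: m_coxeter => _ _ /(_ _ _ _ ij mij).
have ji : j != i by rewrite eq_sym.
have mji : m j i = Some k by case: m_coxeter => <-.
set z := zeta k; have z0 : z != 0 by apply: zeta_neq0; lia.
have zz : z - z^-1 != 0.
  have := @zeta_exp_neq1 k 1; rewrite expr1 => /(_ k1) zz.
  by rewrite subr_eq0 -(inj_eq (mulfI z0)) divff.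
have [E1 E2] := play_alt k f ij mij k1.
have [E3 E4] := play_alt k f ji mji k1.
rewrite -/z in E1 E2 E3 E4; rewrite zeta_exp in E1 E2 E3 E4; try lia.
have EE : play (alt_word k i j) f i = play (alt_word k j i) f i /\
          play (alt_word k i j) f j = play (alt_word k j i) f j.
  split; apply: (mulfI zz); move: E1 E2 E3 E4;
  by case: odd => E1 E2 E3 E4; rewrite ?E1 ?E2 ?E3 ?E4; field.
apply: funext => l.
case: (eqVneq l i) => [->|li]; first by case: EE.
case: (eqVneq l j) => [->|lj]; first by case: EE.
have [al [be inv]] := play_invariant ij mij k1 li lj.
have [] := inv f k; case: EE => -> -> <- /addIr /addIr //.
Qed.

Lemma play_cat u v f : play (u ++ v) f = play v (play u f).
Proof. exact: foldl_cat. Qed.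

Lemma play_pres_eq u v : pres_eq (artin_rel m) u v -> play u =1 play v.
Proof.
elim=> {u v} //.
- by move=> u v _ uv f; rewrite uv.
- by move=> u v w _ uv _ vw f; rewrite uv vw.
- by move=> u u' v v' _ uu _ vv f; rewrite !play_cat uu vv.
- by move=> x b f; exact: fireK.
- by move=> u v [i j k ij mij]; exact: play_braid.
Qed.

(** The form equal to 1 on the i-th simple root and to 0 on the others separates the two words: up
    to the factor [z - z^-1], its coordinate at [if odd t then i else j] becomes
    [-(z ^+ t - z ^- t)] under the first word and [z ^+ t - z ^- t] under the second. *)
Lemma alt_neq i j k t : i != j -> m i j = Some k -> (0 < t < k)%N ->
  ~ pres_eq (artin_rel m) (alt_word t i j) (alt_word t j i).
Proof.
move=> ij mij tk /play_pres_eq /(_ (fun l => (l == i)%:R)) E.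
have k1 : (1 < k)%N by lia.
have ji : j != i by rewrite eq_sym.
have mji : m j i = Some k by case: m_coxeter => <-.
set z := zeta k; have z0 : z != 0 by apply: zeta_neq0; lia.
have zt0 : z ^+ t != 0 by rewrite expf_neq0.
have [] := play_alt t (fun l => (l == i)%:R) ij mij k1.
have [] := play_alt t (fun l => (l == i)%:R) ji mji k1.
rewrite E eqxx (negbTE ji) => _ -> + _; rewrite -/z => /eqP.
rewrite !mul0r mul1r !addr0 add0r -addr_eq0 -mulr2n -mulr_natr.
rewrite mulf_eq0 pnatr_eq0 orbF subr_eq0.
by rewrite -(inj_eq (mulfI zt0)) divff // (negbTE (zeta_exp_neq1 tk)).
Qed.

End NumbersGame.

(** * The height homomorphism to the integers *)

Section Height.
Local Open Scope ring_scope.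
Variables (r : nat) (m : 'M[option nat]_r).

Definition word_height (w : word 'I_r) : int :=
  \sum_(x <- w) (if x.2 then 1 else -1).

Definition height (g : artin m) : int := word_height (repr g).

Lemma word_height_alt t i j : word_height (alt_word t i j) = t%:Z.
Proof.
rewrite /word_height; elim: t i j => [|t IH] i j /=; first by rewrite big_nil.
by rewrite big_cons /= IH; lia.
Qed.

Lemma word_height_pres_eq u v :
  pres_eq (artin_rel m) u v -> word_height u = word_height v.
Proof.
elim=> {u v} //.
- by move=> u v w _ -> _ ->.
- by move=> u u' v v' _ + _; rewrite /word_height !big_cat /= => -> ->.
- by move=> x [] /=; rewrite /word_height !big_cons !big_nil /=; lia.
- by move=> u v [i j k ij mij]; rewrite !word_height_alt.
Qed.

Lemma height_class w : height (pres_class (artin_rel m) w) = word_height w.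
Proof. exact/word_height_pres_eq/pres_repr_class. Qed.

Lemma heightM g h : height (g * h)%g = height g + height h.
Proof.
have -> : (g * h)%g = pres_class (artin_rel m) (repr g ++ repr h) by [].
by rewrite height_class /word_height big_cat.
Qed.

Lemma height_gen i : height (artin_gen m i) = 1.
Proof. by rewrite height_class /word_height big_cons big_nil addr0. Qed.

End Height.

(** * Vertices of the half boundaries *)

Section HalfBoundary.
Local Open Scope group_scope.
Variables (r : nat) (m : 'M[option nat]_r).
Hypothesis m_coxeter : coxeter_matrix m.
Variables (i j : 'I_r).
Hypothesis ij : i != j.
Notation half := (@half_bd r m i j).

Lemma prod_gen (s : seq 'I_r) :
  \prod_(x <- s) artin_gen m x =
    pres_class (artin_rel m) [seq (x, true) | x <- s].
Proof.
elim: s => [|x s IH]; first by rewrite big_nil.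
by rewrite big_cons IH; exact: pres_mulE.
Qed.

Lemma half_bdM b g h t : half b (g * h) t = g * half b h t.
Proof. by rewrite /half_bd mulgA. Qed.

Lemma half_bd0 b g : half b g 0 = g.
Proof. by rewrite /half_bd; case: b; rewrite big_nil mulg1. Qed.

Lemma height_half_bd b g t : (height (half b g t) = height g + t%:Z)%R.
Proof.
by rewrite /half_bd heightM; case: b; rewrite prod_gen height_class word_height_alt.
Qed.

Lemma alt_rcons t (x y : 'I_r) :
  alt t.+1 x y = rcons (alt t x y) (if odd t then y else x).
Proof.
elim: t x y => [|t IH] x y //; rewrite [LHS]/= -/(alt t.+1 y x) IH /=.
by case: odd.
Qed.

Lemma half_bdS b g t :
  half b g t.+1 = half b g t * artin_gen m (if odd t (+) b then i else j).
Proof.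
rewrite /half_bd; case: b; rewrite alt_rcons -cats1 big_cat big_seq1 mulgA;
by case: odd.
Qed.

Lemma half_bd_top k b g : m i j = Some k -> half b g k = half true g k.
Proof.
move=> mij; case: b => //; rewrite /half_bd !prod_gen; congr (_ * _).
by apply/esym/pres_classP/pres_rel/ArtinRel.
Qed.

(** Heights force [t = t'], and then [alt_neq] applies. *)
Lemma half_bd_disjoint k b g t t' : m i j = Some k -> 0 < t < k ->
  half b g t <> half (~~ b) g t'.
Proof.
move=> mij tk E; have /= := congr1 (@height _ _) E.
rewrite !height_half_bd => tt; have {tt} ? : t = t' by lia.
subst t'.
suff : half true g t = half false g t.
  rewrite /half_bd !prod_gen => /mulgI /pres_classP.
  exact: alt_neq mij tk.
by move: E; case: b.
Qed.

Lemma height_half_inj b b' g g' t t' :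
  half b g t = half b' g' t' -> (height g + t%:Z = height g' + t'%:Z)%R.
Proof. by move=> /(congr1 (@height _ _)); rewrite !height_half_bd. Qed.

Lemma Gij_half b t : Gij m i j (half b 1 t).
Proof.
elim: t => [|t IH]; rewrite ?half_bd0 ?half_bdS.
  by move=> H [[]].
move=> H sub; case: (sub) => -[_ HM _] HX.
apply: HM; first exact: IH.
by apply: HX; case: (_ (+) _); [left|right].
Qed.

End HalfBoundary.

(** * The link of an interior vertex *)

Section Dihedral.
Local Open Scope group_scope.
Variables (r : nat) (m : 'M[option nat]_r).
Hypothesis m_coxeter : coxeter_matrix m.
Variables (i j : 'I_r) (k : nat).
Hypothesis ij : i != j.
Hypothesis mij : m i j = Some k.
Notation half := (@half_bd r m i j).
Notation bd := (@bd_vertices r m i j k).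
Notation vertex := (ho_vertex m).

(* A weakening of [meet_in_path g g' (k - d)] which is visibly invariant under
   translation. *)
Definition meets (g g' : artin m) (d : nat) : Prop :=
  0 < d < k.-1 /\ exists b b',
    [/\ g' = half b g d, half true g k = half b' g' (k - d) &
        forall x, bd g x -> bd g' x ->
          (exists2 t, t <= k & x = half b g t) /\
          (exists2 t, t <= k & x = half b' g' t)].

Definition edge (v w : vertex) : Prop :=
  match v, w with
  | Real x, Real y => (exists2 l, l = i \/ l = j & y = x * artin_gen m l) \/ k = 2
  | Inner i1 j1 g s, Real x =>
      [/\ i1 = i, j1 = j, 1 <= s <= k - 2 & exists b t, x = half b g t /\
        [\/ t = s, t = s.+1, s = 1%N /\ t = 0 | s = k - 2 /\ t = k]]
  | Inner i1 j1 g s, Inner i2 j2 g' s' =>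
      [/\ i1 = i /\ i2 = i, j1 = j /\ j2 = j, 1 <= s <= k - 2, 1 <= s' <= k - 2 &
        (g = g' /\ s' = s.+1) \/
        exists2 d, meets g g' d & s = d + s' \/ s.+1 = d + s']
  | _, _ => False
  end.

Definition adj v w := edge v w \/ edge w v.

Lemma bd_half b g t : t <= k -> bd g (half b g t).
Proof. by move=> tk; exists b, t. Qed.

Lemma meet_in_pathM h g g' l : meet_in_path i j k g g' l ->
  meets (h * g) (h * g') (k - l).
Proof.
case=> lk [b [b' [E V _]]]; split; first by lia.
exists b, b'; split.
- by rewrite half_bdM -[k - l]addn0 E // half_bd0.
- rewrite -(half_bd_top ij b _ mij) !half_bdM subKn; last by lia.
  by rewrite -E // subnK //; lia.
- move=> _ [b1 [t1 [tk1 ->]]] [b2 [t2 [tk2]]].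
  rewrite !half_bdM => /mulgI E12.
  have : (bd g `&` bd g')%classic (half b1 g t1).
    by split; [|rewrite E12]; exact: bd_half.
  rewrite V => -[t [tl ->]]; split; last by exists t; rewrite ?half_bdM //; lia.
  by exists (k - l + t); [lia|rewrite -E // half_bdM].
Qed.

Lemma dihedral_edge_adj h v w : dihedral_edge i j k v w ->
  adj (ho_act h v) (ho_act h w).
Proof.
case=> {v w}.
- by move=> g x _ xij; left; left; exists x; rewrite ?mulgA.
- by move=> g _ k2; left; right.
- move=> g _ k3; right; split=> //; first by lia.
  by exists true, 0; rewrite half_bdM; split=> //; constructor 3.
- move=> g _ k3; left; split=> //; first by lia.
  by exists true, k; rewrite half_bdM; split=> //; constructor 4.
- by move=> g s _ sk; left; split=> //; [lia|lia|left].
- move=> g s b _ sk; left; split=> //.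
  by exists b, s; rewrite half_bdM; split=> //; constructor 1.
- move=> g s b _ sk; left; split=> //.
  by exists b, s.+1; rewrite half_bdM; split=> //; constructor 2.
- move=> g g' l s _ _ M sl; have [lk _] := M.
  left; split=> //; [lia|lia|right; exists (k - l); first exact: meet_in_pathM].
  by right; lia.
- move=> g g' l s _ _ M sl; have [lk _] := M.
  right; split=> //; [lia|lia|right; exists (k - l); first exact: meet_in_pathM].
  by left; lia.
Qed.

(** Two meeting precells as seen from the one at [g], regardless of which comes first: [b] is the
    half boundary of [g] carrying the common vertices, and an end of the other precell lies strictly
    inside it. *)
Definition overlap b (g g' : artin m) : Prop :=
  (forall x, bd g x -> bd g' x -> exists2 t, t <= k & x = half b g t) /\
  exists2 t, 0 < t < k & g' = half b g t \/ half true g' k = half b g t.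

Lemma meets_overlap g g' d : meets g g' d ->
  (exists b, overlap b g g') /\ (exists b, overlap b g' g).
Proof.
case=> dk [b [b' [E E' V]]]; split.
- exists b; split; first by move=> x gx g'x; case: (V x gx g'x).
  by exists d; [lia|left].
- exists b'; split; first by move=> x g'x gx; case: (V x gx g'x).
  by exists (k - d); [lia|right].
Qed.

(** A single precell would have ends inside both half boundaries of [g]. If it is the same end, the
    halves are not disjoint; the two different ends are too far apart in height. *)
Lemma overlap_opp_neq b g g1 g2 :
  overlap b g g1 -> overlap (~~ b) g g2 -> g1 <> g2.
Proof.
move=> [_ [t1 tk1 E1]] [_ [t2 tk2 E2]] E; subst g2.
case: E1 E2 => E1 [] E2.
- by apply: (@half_bd_disjoint _ _ m_coxeter _ _ ij _ b g t1 t2 mij tk1); rewrite -E1.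
- have := congr1 (@height _ _) E1; have := congr1 (@height _ _) E2.
  by rewrite !height_half_bd; lia.
- have := congr1 (@height _ _) E1; have := congr1 (@height _ _) E2.
  by rewrite !height_half_bd; lia.
- by apply: (@half_bd_disjoint _ _ m_coxeter _ _ ij _ b g t1 t2 mij tk1); rewrite -E1.
Qed.

(** The initial vertex of the precell at [g2] lies on the boundary of the one at [g1], and the
    terminal vertex of the latter on the boundary of the former. If either of these is the end
    inside a half boundary of [g], it lies on the opposite half as well. The remaining case is
    excluded by heights. *)
Lemma overlap_opp_meets b g g1 g2 d :
  overlap b g g1 -> overlap (~~ b) g g2 -> ~ meets g1 g2 d.
Proof.
move=> [V1 [t1 tk1 E1]] [V2 [t2 tk2 E2]] [dk [b1 [b2 [E E' _]]]].
case: E2 => E2.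
- have [||t tk F] := V1 g2.
  + by rewrite E2; apply: bd_half; lia.
  + by rewrite E; apply: bd_half; lia.
  + by apply: (@half_bd_disjoint _ _ m_coxeter _ _ ij _ (~~ b) g t2 t mij tk2);
       rewrite -E2 negbK.
case: E1 => E1.
  have := congr1 (@height _ _) E1; have := congr1 (@height _ _) E2.
  by have := congr1 (@height _ _) E; rewrite !height_half_bd; lia.
have [||t tk F] := V2 (half true g1 k).
- by rewrite E1; apply: bd_half; lia.
- by rewrite E'; apply: bd_half; lia.
- by apply: (@half_bd_disjoint _ _ m_coxeter _ _ ij _ b g t1 t mij tk1); rewrite -E1.
Qed.

Definition side b g s (v : vertex) : Prop :=
  match v with
  | Real x => x = half b g s \/ x = half b g s.+1
  | Inner _ _ g' _ => overlap b g g'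
  end.

Lemma side_opp_edge b g s v w : 1 <= s <= k - 2 ->
  side b g s v -> side (~~ b) g s w -> ~ edge v w.
Proof.
move=> sk; case: v w => [x|i1 j1 g1 s1] [y|i2 j2 g2 s2] //=.
- move=> X Y [|]; last by lia.
  move=> [l lij]; have {X} [t tt ->] : exists2 t, t = s \/ t = s.+1 & x = half b g t.
    by case: X => ->; [exists s|exists s.+1]; auto.
  have {Y} [t' tt' ->] :
      exists2 t, t = s \/ t = s.+1 & y = half (~~ b) g t.
    by case: Y => ->; [exists s|exists s.+1]; auto.
  move=> E; have := congr1 (@height _ _) E.
  rewrite heightM height_gen !height_half_bd => H.
  have [? ?] : t = s /\ t' = s.+1 by lia.
  subst t t'.
  (* The edge has the label of the next edge of one of the two half boundaries. Either it leads to
     the vertex of index [s.+1] on half [b], or cancelling the generator identifies the two vertices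
     of index [s]. *)
  have : half (~~ b) g s.+1 = half b g s.+1 \/ half (~~ b) g s = half b g s.
    move: E; rewrite !half_bdS; case: lij => ->; case: (odd s) b => [] [] //= E;
    by [left|right; exact: mulIg E].
  by case=> /esym; apply: half_bd_disjoint mij _ => //; lia.
- by move=> _ _ [].
- move=> [V _] Y [_ _ s1k [b' [t [E tt]]]].
  have {Y} [t' tt' Y] : exists2 t, t = s \/ t = s.+1 & y = half (~~ b) g t.
    by case: Y => ->; [exists s|exists s.+1]; auto.
  (* The edge puts [y] on the boundary of the precell at [g1], so the overlap places it on half [b]
     too. *)
  have [||t0 _ F] := V y.
  + by rewrite Y; apply: bd_half; lia.
  + by rewrite E; apply: bd_half; move: tt => []; lia.
  + have FY : half b g t0 = half (~~ b) g t' by rewrite -F -Y.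
    apply: (half_bd_disjoint m_coxeter ij mij _ FY).
    by have := height_half_inj FY; lia.
- move=> o1 o2 [_ _ _ _ [E|[d M _]]]; first exact: (overlap_opp_neq o1 o2 (proj1 E)).
  exact: (overlap_opp_meets o1 o2 M).
Qed.

Lemma side_opp_adj b g s v w : 1 <= s <= k - 2 ->
  side b g s v -> side (~~ b) g s w -> ~ adj v w.
Proof.
move=> sk sv sw [|]; first exact: (side_opp_edge sk sv sw).
by apply: (@side_opp_edge (~~ b) g s); rewrite ?negbK.
Qed.

Lemma side_opp_neq b g s v w : 1 <= s <= k - 2 ->
  side b g s v -> side (~~ b) g s w -> v <> w.
Proof.
move=> sk sv sw E; subst w.
case: v sv sw => [x|i1 j1 g1 s1] /= X Y; last exact: (overlap_opp_neq X Y).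
have {X} [t tt E] : exists2 t, t = s \/ t = s.+1 & x = half b g t.
  by case: X => ->; [exists s|exists s.+1]; auto.
have {Y} [t' tt' E'] : exists2 t, t = s \/ t = s.+1 & x = half (~~ b) g t.
  by case: Y => ->; [exists s|exists s.+1]; auto.
apply: (@half_bd_disjoint _ _ m_coxeter _ _ ij _ b g t t' mij); first lia.
by rewrite -E.
Qed.

(* The interior vertices of a precell form a path, which is prolonged here by
   the initial vertex at [0] and by the terminal vertex at [k - 1]. *)
Definition axis g s : vertex :=
  if s == 0 then Real g
  else if s == k.-1 then Real (half true g k) else Inner i j g s.

Lemma adj_inner g s w : 1 <= s <= k - 2 -> adj (Inner i j g s) w ->
  [\/ w = axis g s.+1, w = axis g s.-1 | exists b, side b g s w].
Proof.
move=> sk; case: w => [x|i' j' g' s'] /=; rewrite /adj /=.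
  move=> [|//] [_ _ _ [b [t [-> [-> | -> | [s1 ->] | [s2 ->]]]]]].
  - by constructor 3; exists b; left.
  - by constructor 3; exists b; right.
  - by constructor 2; rewrite s1 half_bd0.
  - constructor 1; rewrite /axis (half_bd_top _ _ _ mij) //.
    by rewrite [_ == k.-1](_ : _ = true) //; lia.
move=> [|] [[? ?] [? ?] s1 s2]; subst i' j'.
  case=> [[? ?]|[d M _]]; last by constructor 3; have [] := meets_overlap M.
  subst g' s'; constructor 1; rewrite /axis /=.
  by rewrite [_ == k.-1](_ : _ = false) //; lia.
case=> [[? ?]|[d M _]]; last by constructor 3; have [] := meets_overlap M.
subst g' s; constructor 2; rewrite /axis /=.
rewrite [_ == 0](_ : _ = false); last lia.
by rewrite [_ == k.-1](_ : _ = false) //; lia.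
Qed.

(** The trace of adjacency on heights and indices: linear constraints, which [lia] can decide. *)
Definition height_adj (v w : vertex) : Prop :=
  match v, w with
  | Real x, Real y =>
      (height x = height y + 1 \/ height y = height x + 1)%R
  | Inner _ _ g s, Real x | Real x, Inner _ _ g s =>
      (height x = height g + s%:Z \/ height x = height g + s.+1%:Z \/
       s = 1%N /\ height x = height g \/
       s = (k - 2)%N /\ height x = height g + k%:Z)%R
  | Inner _ _ g s, Inner _ _ g' s' =>
      1 <= s <= k - 2 /\ 1 <= s' <= k - 2 /\
      (height g = height g' /\ (s' = s.+1 \/ s = s'.+1) \/
       0 < height g' - height g < k%:Z - 1 /\
         (s%:Z = height g' - height g + s'%:Z \/
          s.+1%:Z = height g' - height g + s'%:Z) \/
       0 < height g - height g' < k%:Z - 1 /\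
         (s'%:Z = height g - height g' + s%:Z \/
          s'.+1%:Z = height g - height g' + s%:Z))%R
  end.

Lemma adj_height v w : 3 <= k -> adj v w -> height_adj v w.
Proof.
move=> k3; case: v w => [x|i1 j1 g1 s1] [y|i2 j2 g2 s2]; rewrite /adj /=.
- by move=> [] [[l _ ->]|]; rewrite ?heightM ?height_gen; lia.
- by move=> [//|] [_ _ _ [b [t [-> []]]]]; rewrite height_half_bd; lia.
- by move=> [|//] [_ _ _ [b [t [-> []]]]]; rewrite height_half_bd; lia.
- by move=> [] [_ _ ? ? [[-> ?]|[d [dk [b [_ [-> _ _]]]]]]];
    rewrite ?height_half_bd; lia.
Qed.

Definition height_near (v w : vertex) : Prop :=
  height_adj v w \/
  match v, w with
  | Real x, Real y => height x = height y
  | Inner _ _ g s, Inner _ _ g' s' => height g = height g' /\ s = s'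
  | _, _ => False
  end.

Definition near (v w : vertex) : Prop := v = w \/ adj v w.

Lemma near_height v w : 3 <= k -> near v w -> height_near v w.
Proof.
move=> k3 [->|/adj_height]; last by left; auto.
by right; case: w.
Qed.

(** Heights suffice: for instance, relative to [g], the neighbours of o_{s-1} on the half boundaries
    have heights s-1 and s, those of o_{s+1} have s+1 and s+2. Adjacency to o_s rules out [x] = o_s,
    which is near both. *)
Lemma axis_ends_far g s x : 1 <= s <= k - 2 ->
  near x (axis g s.+1) -> near x (axis g s.-1) -> ~ adj x (Inner i j g s).
Proof.
move=> sk /near_height U /near_height D /adj_height A.
have k3 : 3 <= k by lia.
move: (U k3) (D k3) (A k3) => {U D A}; rewrite /axis.
rewrite [s.+1 == 0]/= [s.-1 == k.-1](_ : _ = false); last by lia.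
case: (s.+1 =P k.-1) => e1; case: (s.-1 =P 0) => e2; case: x => [x|i' j' g' s'];
  rewrite /height_near /= ?height_half_bd;
  by lia.
Qed.

Lemma half_succ_far b g s : 1 <= s <= k - 2 ->
  ~ near (axis g s.-1) (Real (half b g s.+1)).
Proof.
move=> sk /near_height -/(_ ltac:(lia)); rewrite /axis.
rewrite [s.-1 == k.-1](_ : _ = false); last by lia.
case: (s.-1 =P 0) => e; rewrite /height_near /= ?height_half_bd; lia.
Qed.

Lemma half_far b g s : 1 <= s <= k - 2 ->
  ~ near (axis g s.+1) (Real (half b g s)).
Proof.
move=> sk /near_height -/(_ ltac:(lia)); rewrite /axis.
rewrite [s.+1 == 0]/=.
case: (s.+1 =P k.-1) => e; rewrite /height_near /= ?height_half_bd; lia.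
Qed.

Lemma adjC v w : adj v w -> adj w v.
Proof. by case; [right|left]. Qed.

Lemma nearC v w : near v w -> near w v.
Proof. by case=> [->|/adjC]; [left|right]. Qed.

(* The second condition on directed geodesics, for the vertices t, c, d. *)
Definition separated t c d := forall x, near x t -> adj x c -> near x d -> False.

Lemma separated_axis_up g s : 1 <= s <= k - 2 ->
  separated (axis g s.-1) (Inner i j g s) (axis g s.+1).
Proof. by move=> sk x D A U; exact: (axis_ends_far sk U D A). Qed.

Lemma separated_axis_down g s : 1 <= s <= k - 2 ->
  separated (axis g s.+1) (Inner i j g s) (axis g s.-1).
Proof. by move=> sk x U A D; exact: (axis_ends_far sk U D A). Qed.

Lemma separated_side b g s t : 1 <= s <= k - 2 ->
  side b g s t -> adj t (Inner i j g s) ->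
  exists2 u, u = s \/ u = s.+1 &
    separated t (Inner i j g s) (Real (half (~~ b) g u)).
Proof.
move=> sk st tc.
(* A vertex on the side of [t] is not near the chosen real vertex, and one on the opposite side is
   not near [t]. *)
have sides x u : u = s \/ u = s.+1 -> near x t -> near x (Real (half (~~ b) g u)) ->
    (exists b', side b' g s x) -> False.
  move=> uu xt xd [b' sx].
  have sd : side (~~ b) g s (Real (half (~~ b) g u)) by case: uu => ->; [left|right].
  have [bb|bb] : b' = b \/ b' = ~~ b by case: (b') (b) => [] []; auto.
  - subst b'; case: xd => E; first exact: (side_opp_neq sk sx sd E).
    exact: (side_opp_adj sk sx sd E).
  - subst b'; case: (nearC xt) => E; first exact: (side_opp_neq sk st sx E).
    exact: (side_opp_adj sk st sx E).
(* If [t] is near o_{s+1}, it is not near o_{s-1}, and the vertex of index [s] is not near o_{s+1}.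
   Otherwise index [s.+1] works, being far from o_{s-1}. *)
have [ut|ut] := pselect (near (axis g s.+1) t).
  exists s; first by left.
  move=> x xt xc xd; have [E|E|S] := adj_inner sk (adjC xc).
  - by rewrite E in xd; exact: (half_far sk xd).
  - by rewrite E in xt; exact: (axis_ends_far sk (nearC ut) (nearC xt) tc).
  - by apply: sides xt xd S; left.
exists s.+1; first by right.
move=> x xt xc xd; have [E|E|S] := adj_inner sk (adjC xc).
- by apply: ut; rewrite -E.
- by rewrite E in xd; exact: (half_succ_far sk xd).
- by apply: sides xt xd S; right.
Qed.

End Dihedral.

Local Open Scope classical_set_scope.

(** * Directed geodesics *)

Section DirectedGeodesics.
Variables (V : Type) (K : set (set V)).
Implicit Types (s t : set V) (c : seq (set V)).

Definition turn s t u : Prop :=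
  Res s (link K t) `&` B1 u (link K t) = set0.

Lemma directed_geodesic_rcons c s t :
  directed_geodesic K (rcons c s) -> K t -> s `&` t = set0 -> K (s `|` t) ->
  (c <> [::] -> turn (last set0 c) s t) ->
  directed_geodesic K (rcons (rcons c s) t).
Proof.
move=> [Hs Ha Ht] Kt st Kst tu.
have nth_old p : (p < (size c).+1)%N ->
    nth set0 (rcons (rcons c s) t) p = nth set0 (rcons c s) p.
  by move=> pc; rewrite [LHS]nth_rcons size_rcons pc.
have nth_s : nth set0 (rcons c s) (size c) = s by rewrite nth_rcons ltnn eqxx.
have nth_t : nth set0 (rcons (rcons c s) t) (size c).+1 = t.
  by rewrite nth_rcons size_rcons ltnn eqxx.
split=> p; rewrite !size_rcons.
- rewrite leq_eqVlt => /orP[/eqP[->]|pc]; first by rewrite nth_t.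
  by rewrite nth_old //; apply: Hs; rewrite size_rcons.
- rewrite leq_eqVlt => /orP[/eqP[->]|pc]; first by rewrite nth_t nth_old // nth_s.
  by rewrite !nth_old //; [apply: Ha; rewrite size_rcons|lia].
- rewrite leq_eqVlt => /orP[/eqP[pc]|pc]; last first.
    by rewrite !nth_old //; [apply: Ht; rewrite size_rcons|lia|lia].
  have {}pc : size c = p.+1 by lia.
  rewrite -pc nth_t !nth_old ?pc // -pc nth_s nth_rcons pc ltnSn.
  have -> : nth set0 c p = last set0 c by rewrite -nth_last pc.
  by apply: tu => c0; rewrite c0 in pc.
Qed.

(** The last simplex enters the second condition on directed geodesics only through [B1], which is
    monotone in it. *)
Lemma directed_geodesic_last_vertex c s v :
  (forall t t', K t -> t' !=set0 -> t' `<=` t -> K t') ->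
  directed_geodesic K (rcons c s) -> s v -> directed_geodesic K (rcons c [set v]).
Proof.
move=> K_sub [Hs Ha Ht] sv.
have vs : [set v] `<=` s by move=> _ ->.
have nth_old t p : (p < size c)%N -> nth set0 (rcons c t) p = nth set0 c p.
  by move=> pc; rewrite nth_rcons pc.
have nth_s t : nth set0 (rcons c t) (size c) = t by rewrite nth_rcons ltnn eqxx.
split=> p; rewrite size_rcons.
- move: (Hs p); rewrite size_rcons leq_eqVlt => H /orP[/eqP[pc]|pc].
    subst p; move: H; rewrite !nth_s => H; apply: K_sub (H _) _ vs => //.
      by rewrite eqxx.
    by exists v.
  by move: H; rewrite !nth_old // pc orbT; exact.
- move: (Ha p); rewrite size_rcons leq_eqVlt => H /orP[/eqP[pc]|pc].
    move: H; rewrite pc eqxx /= => /(_ isT); rewrite !nth_s !nth_old -?pc // => -[E H].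
    split; last first.
      apply: K_sub H _ _; first by exists v; right.
      exact: setUS.
    by apply/seteqP; split=> // x [cx vx]; rewrite -E; split=> //; exact: vs.
  by move: H; rewrite !nth_old ?pc ?orbT //; try lia; apply.
- move: (Ht p); rewrite size_rcons leq_eqVlt => H /orP[/eqP[pc]|pc].
    move: H; rewrite pc eqxx /= => /(_ isT); rewrite !nth_s !nth_old -?pc //; try lia.
    move=> E; apply/seteqP; split=> // x [cx [Lx [u [Lu [y [uy yv]] xu]]]].
    rewrite -E; split=> //; split=> //; exists u; split=> //.
    by exists v; split=> //; rewrite -yv.
  by move: H; rewrite !nth_old ?pc ?orbT //; try lia; apply.
Qed.

(** The turn at [f 0] is a separate hypothesis because the simplex preceding it need not be a
    vertex, or may not exist. *)
Lemma directed_geodesic_chain (N : nat) c (f : nat -> V) :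
  (forall t t', K t -> t' !=set0 -> t' `<=` t -> K t') ->
  directed_geodesic K (rcons c [set f 0]) ->
  (forall n, (n < N)%N -> K ([set f n] `|` [set f n.+1]) /\ f n <> f n.+1) ->
  (forall n, (n.+1 < N)%N -> turn [set f n] [set f n.+1] [set f n.+2]) ->
  ((0 < N)%N -> c <> [::] -> turn (last set0 c) [set f 0] [set f 1]) ->
  directed_geodesic K
    (rcons c [set f 0] ++ [seq [set x] | x <- [seq f n | n <- iota 1 N]]).
Proof.
move=> K_sub; elim: N c f => [|N IH] c f dg Kf tf tc; first by rewrite cats0.
have -> : iota 1 N.+1 = 1%N :: [seq n.+1 | n <- iota 1 N].
  by rewrite /= (iotaDl 1 1).
rewrite /= -cat_rcons -[[seq f n | n <- _]]map_comp.
have [K01 f01] := Kf 0 isT.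
apply: (IH _ (fun n => f n.+1)).
- apply: (directed_geodesic_rcons dg _ _ K01 (tc isT)).
    apply: (K_sub _ _ K01); first by exists (f 1).
    exact: subsetUr.
  by apply/seteqP; split=> // x [-> ] /=.
- by move=> n nN; exact: Kf.
- by move=> n nN; exact: tf.
- by move=> N0 _; rewrite last_rcons; exact: tf.
Qed.

End DirectedGeodesics.

(** * Simplices of the Huang-Osajda complex *)

Section Complex.
Variables (r : nat) (m : 'M[option nat]_r).
Hypothesis m_coxeter : coxeter_matrix m.
Notation vertex := (ho_vertex m).
Notation K := (ho_complex m).

Lemma ho_complex_sub t t' : K t -> t' !=set0 -> t' `<=` t -> K t'.
Proof.
move=> Kt [v tv] sub; case: Kt => [[[g E]|[g [i E]]]|[i [j [k [h [u [ij mij du E]]]]]]].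
- left; left; exists g; apply/seteqP; split; first by rewrite -E.
  by move=> _ ->; have := sub v tv; rewrite E => <-.
- left; have [g0|g0] := pselect (t' (Real g)).
    have [g1|g1] := pselect (t' (Real (g * artin_gen m i)%g)).
      right; exists g, i; apply/seteqP; split; first by rewrite -E.
      by move=> x [->|->].
    left; exists g; apply/seteqP; split; last by move=> _ ->.
    by move=> x t'x; have := sub x t'x; rewrite E => -[//|xE]; rewrite xE in t'x.
  left; exists (g * artin_gen m i)%g.
  have sub' : t' `<=` [set Real (g * artin_gen m i)%g].
    by move=> x t'x; have := sub x t'x; rewrite E => -[xE|//]; rewrite xE in t'x.
  by apply/seteqP; split=> // _ ->; rewrite -(sub' _ tv).
- right; exists i, j, k, h, (u `&` ho_act h @^-1` t'); split=> //.
    case: du => fu _ uV uE; split.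
    + by apply: sub_finite_set fu => x [].
    + have := sub v tv; rewrite E => -[x ux xv].
      by exists x; split=> //; rewrite /= xv.
    + by move=> x [ux _]; exact: uV.
    + by move=> x y [ux _] [uy _]; exact: uE.
  apply/seteqP; split; last by move=> _ [x [_ xt] <-].
  move=> x t'x; have := sub x t'x; rewrite E => -[y uy yx].
  by exists y => //; split=> //; rewrite /= yx.
Qed.

Lemma ho_complex_neq0 t : K t -> t !=set0.
Proof.
case=> [[[g ->]|[g [i ->]]]|[i [j [k [h [u [_ _ [_ [x ux] _ _] ->]]]]]]].
- by exists (Real g).
- by exists (Real g); left.
- by exists (ho_act h x); exists x.
Qed.

(** An interior vertex records its pair [i], [j], so a simplex containing it comes from a translate
    of the dihedral complex of that pair. *)
Lemma simplex_inner i j g s t : K t -> t (Inner i j g s) ->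
  exists k, [/\ (i < j)%N, m i j = Some k, 1 <= s <= k - 2 &
    forall v w, t v -> t w -> v <> w -> adj i j k v w].
Proof.
case=> [[[g1 ->]|[g1 [i1 ->]]]|[i1 [j1 [k [h [u [ij mij [_ _ uV uE] ->]]]]]]] //.
  by case.
case=> v uv vE; case: (uV v uv) vE => [[g1 _ ->]//|[g1 [s1 [_ sk ->]]]] /= [? ? _ ?].
subst i1 j1 s1; exists k; split=> //.
have ij' : i != j by rewrite neq_ltn ij.
move=> _ _ [v1 uv1 <-] [w1 uw1 <-] vw.
have [|E|E] := uE v1 w1 uv1 uw1; first by move=> E; rewrite E in vw.
- exact: dihedral_edge_adj.
- by apply: adjC; exact: dihedral_edge_adj.
Qed.

Lemma ho_complex_edge (i j : 'I_r) k h v w : (i < j)%N -> m i j = Some k ->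
  dihedral_vertices m i j k v -> dihedral_vertices m i j k w ->
  dihedral_edge i j k v w -> K [set ho_act h v; ho_act h w].
Proof.
move=> ij mij Vv Vw E; right; exists i, j, k, h, [set v; w]; split=> //.
  split.
  - by rewrite finite_setU; split; exact: finite_set1.
  - by exists v; left.
  - by move=> _ [->|->].
  - by move=> _ _ [->|->] [->|->] // _; [left|right].
by rewrite image_setU !image_set1.
Qed.

Section Cell.
Variables (i j : 'I_r) (k : nat).
Hypothesis ij : (i < j)%N.
Hypothesis mij : m i j = Some k.
Let ij' : i != j. Proof. by rewrite neq_ltn ij. Qed.

Lemma half_vertex b t : dihedral_vertices m i j k (Real (half_bd i j b 1%g t)).
Proof. by left; exists (half_bd i j b 1%g t) => //; exact: Gij_half. Qed.

Lemma Gij1 : Gij m i j 1%g.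
Proof. by rewrite -(half_bd0 i j true 1%g); exact: Gij_half. Qed.

Lemma inner_vertex s : 1 <= s <= k - 2 ->
  dihedral_vertices m i j k (Inner i j 1%g s).
Proof. by move=> sk; right; exists 1%g, s; split=> //; exact: Gij1. Qed.

Lemma ho_act_half g b t :
  ho_act g (Real (half_bd i j b 1%g t)) = Real (half_bd i j b g t) :> vertex.
Proof. by rewrite /= -half_bdM mulg1. Qed.

Lemma ho_act_inner g s : ho_act g (Inner i j 1%g s) = Inner i j g s :> vertex.
Proof. by rewrite /= mulg1. Qed.

Lemma axis_edge g s : 2 < k -> s < k.-1 ->
  K [set axis i j k g s; axis i j k g s.+1].
Proof.
move=> k3 sk; have G1 := Gij1; rewrite /axis.
rewrite [s == k.-1](_ : _ = false); last by lia.
rewrite [s.+1 == 0]/=.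
case: (s =P 0) => s0; case: (s.+1 =P k.-1) => s1; try lia.
- rewrite s0 -[in Real g](half_bd0 i j true g) -ho_act_half -ho_act_inner.
  apply: (ho_complex_edge g ij mij); [exact: half_vertex|apply: inner_vertex; lia|].
  exact: edge_initial.
- rewrite -ho_act_half -ho_act_inner.
  apply: (ho_complex_edge g ij mij); [apply: inner_vertex; lia|exact: half_vertex|].
  by rewrite [s](_ : _ = k - 2); [exact: edge_terminal|lia].
- rewrite -(ho_act_inner g s) -(ho_act_inner g s.+1).
  apply: (ho_complex_edge g ij mij); [apply: inner_vertex; lia..|].
  by apply: edge_inner => //; lia.
Qed.

Lemma axis_neq g s : 2 < k -> axis i j k g s <> axis i j k g s.+1 :> vertex.
Proof.
move=> k3; rewrite /axis [s.+1 == 0]/=.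
case: (s =P 0) => s0; case: (s.+1 =P k.-1) => s1; case: (s =P k.-1) => s2;
  try lia; move=> [] //; lia.
Qed.

Lemma half_edge g s b t : 1 <= s <= k - 2 -> t = s \/ t = s.+1 ->
  K [set Inner i j g s; Real (half_bd i j b g t)].
Proof.
move=> sk st; have G1 := Gij1; rewrite -ho_act_half -ho_act_inner.
apply: (ho_complex_edge g ij mij); [exact: inner_vertex|exact: half_vertex|].
by case: st => ->; [exact: edge_half|exact: edge_half_succ].
Qed.

(** For a vertex [x] of a simplex in both sets, [Res] makes [x] near every vertex of [tau], [B1]
    makes it near [d], and the link makes it adjacent to o_s. Hence a single vertex [t] of [tau]
    suffices. *)
Lemma separated_turn g s t d tau : tau t ->
  separated i j k t (Inner i j g s) d ->
  turn K tau [set Inner i j g s] [set d].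
Proof.
move=> taut sep; apply/seteqP; split=> // y [[Ly [u [[Ku uc Kuc] tu yu]]]].
case=> _ [u' [[Ku' u'c Ku'c] [z [u'z zd]] yu']].
have u'd : u' d by rewrite -zd.
have [x yx] : y !=set0 by case: Ly => /ho_complex_neq0.
have nearP v : K (v `|` [set Inner i j g s]) -> forall a b, v a -> v b -> near i j k a b.
  move=> Kv a b va vb; have [->|ab] := pselect (a = b); first by left.
  have [|k' [_ mij' _ H]] := simplex_inner (i := i) (j := j) (g := g) (s := s) Kv.
    by right.
  right; have -> : k = k' by apply/esym; move: mij'; rewrite mij => -[].
  by apply: H => //; left.
apply: (sep x); [exact: nearP Kuc _ _ (yu x yx) (tu _ taut)| |
  exact: nearP Ku'c _ _ (yu' x yx) u'd].
have [|k' [_ mij' _ H]] := simplex_inner (i := i) (j := j) (g := g) (s := s) Kuc.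
  by right.
have -> : k = k' by apply/esym; move: mij'; rewrite mij => -[].
apply: H; [left; exact: yu|by right|move=> xE].
have : (u `&` [set Inner i j g s]) x by split; [exact: yu|].
by rewrite uc.
Qed.

End Cell.
End Complex.

(** * Continuing from an interior vertex to a real one *)

Lemma max_label_geq (r : nat) (m : 'M[option nat]_r) i j k :
  i != j -> m i j = Some k -> k <= max_label m.
Proof.
move=> ij mij; have := @leq_bigmax_cond _ (fun l => i != l) (fun l => odflt 0 (m i l)) j ij.
rewrite mij => /leq_trans; apply.
exact: (@leq_bigmax _ (fun l => \max_(l' < r | l != l') odflt 0 (m l l')) i).
Qed.

Section Extension.
Variables (r : nat) (m : 'M[option nat]_r).
Hypothesis m_coxeter : coxeter_matrix m.
Notation K := (ho_complex m).

Lemma geodesic_to_real (c : seq (set (ho_vertex m))) (i j : 'I_r) g s :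
  directed_geodesic K (rcons c [set Inner i j g s]) ->
  exists (k : nat) (w : k.-tuple (ho_vertex m)),
    [/\ directed_geodesic K
          (rcons c [set Inner i j g s] ++ [seq [set x] | x <- w]),
        is_real (last (Inner i j g s) w) & k <= max_label m - 2].
Proof.
move=> dg; set v := Inner i j g s in dg *.
have Kv : K [set v].
  case: dg => /(_ (size c)); rewrite size_rcons => /(_ (ltnSn _)).
  by rewrite nth_rcons ltnn eqxx.
have [k [ij mij sk _]] := simplex_inner Kv (erefl : [set v] v).
have ij' : i != j by rewrite neq_ltn ij.
have kM := max_label_geq ij' mij; have k3 : 2 < k by lia.
have axis_s : axis i j k g s = v.
  rewrite /axis [s == 0](_ : _ = false); last lia.
  by rewrite [s == k.-1](_ : _ = false) //; lia.
pose goal := exists (k : nat) (w : k.-tuple (ho_vertex m)),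
    [/\ directed_geodesic K (rcons c [set v] ++ [seq [set x] | x <- w]),
        is_real (last v w) & k <= max_label m - 2].
have chain (f : nat -> ho_vertex m) N : f 0 = v -> N <= k - 2 ->
    (forall n, n < N -> K ([set f n] `|` [set f n.+1]) /\ f n <> f n.+1) ->
    (forall n, n.+1 < N -> turn K [set f n] [set f n.+1] [set f n.+2]) ->
    (c <> [::] -> turn K (last set0 c) [set f 0] [set f 1]) ->
    is_real (f N) ->
    goal.
  move=> f0 Nk Kf tf tc realN.
  have sN : size [seq f n | n <- iota 1 N] == N by rewrite size_map size_iota.
  exists N, (Tuple sN); split=> //=; last by lia.
    by rewrite -f0; apply: directed_geodesic_chain => //;
      [exact: ho_complex_sub|rewrite f0].
  rewrite -f0 last_map.
  by have -> : last 0 (iota 1 N) = N by rewrite -nth_last; case: (N) => // n;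
    rewrite size_iota nth_iota.
(* The terminal vertex has axis index [k.-1]; it is reached in [k.-1 - s] steps, at most [k - 2]
   because [s] is positive. *)
have up : (c <> [::] -> turn K (last set0 c) [set v] [set axis i j k g s.+1]) ->
    goal.
  move=> tc; apply: (chain (fun n => axis i j k g (s + n)) (k.-1 - s)).
  - by rewrite addn0.
  - by lia.
  - move=> n nN; rewrite addnS; split; last exact: axis_neq.
    by apply: axis_edge => //; lia.
  - move=> n nN; rewrite !addnS.
    have E : axis i j k g (s + n).+1 = Inner i j g (s + n).+1.
      by rewrite /axis [_ == k.-1](_ : _ = false) //; lia.
    rewrite E; apply: (separated_turn mij (t := axis i j k g (s + n))) => //.
    by apply: (separated_axis_up ij' (s := (s + n).+1)); lia.
  - by rewrite addn0 axis_s addn1.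
  - rewrite /axis [_ == 0](_ : _ = false); last lia.
    rewrite [_ == k.-1](_ : _ = true); last lia.
    by exists (half_bd i j true g k).
(* The initial vertex has axis index [0], and [s] is at most [k - 2]. *)
have down : (c <> [::] -> turn K (last set0 c) [set v] [set axis i j k g s.-1]) ->
    goal.
  move=> tc; apply: (chain (fun n => axis i j k g (s - n)) s).
  - by rewrite subn0.
  - by lia.
  - move=> n nN; have -> : s - n = (s - n.+1).+1 by lia.
    split; last by move/esym; exact: axis_neq.
    by rewrite setUC; apply: axis_edge => //; lia.
  - move=> n nN.
    have E : axis i j k g (s - n.+1) = Inner i j g (s - n.+1).
      rewrite /axis [_ == 0](_ : _ = false); last lia.
      by rewrite [_ == k.-1](_ : _ = false) //; lia.
    rewrite E; apply: (separated_turn mij (t := axis i j k g (s - n))) => //.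
    have -> : s - n = (s - n.+1).+1 by lia.
    have -> : s - n.+2 = (s - n.+1).-1 by lia.
    by apply: separated_axis_down => //; lia.
  - by rewrite subn0 axis_s subn1.
  - by rewrite subnn; exists g.
(* With no simplex before [v] there is no turn condition at [v]. *)
have [c0|c0] := pselect (c = [::]); first by apply: up => /(_ c0).
pose tau := last set0 c.
have [Ktau Ktv tv] : [/\ K tau, K (tau `|` [set v]) & tau `&` [set v] = set0].
  case: dg => /(_ (size c).-1) + /(_ (size c).-1) + _; rewrite size_rcons.
  have -> : (size c).-1.+1 = size c by case: (c) c0.
  rewrite !nth_rcons ltnn eqxx leqnSn ltnSn.
  have -> : ((size c).-1 < size c)%N by case: (c) c0.
  by rewrite nth_last => /(_ isT) ? /(_ isT) [? ?].
have [t tt] := ho_complex_neq0 Ktau.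
have t_adj : adj i j k t v.
  have [|k' [_ mij' _ H]] := simplex_inner (i := i) (j := j) (g := g) (s := s) Ktv.
    by right.
  have -> : k = k' by apply/esym; move: mij'; rewrite mij => -[].
  apply: H; [by left|by right|move=> tE].
  by have : (tau `&` [set v]) t by []; rewrite tv.
have [tE|tE|[b tS]] := adj_inner ij' mij sk (adjC t_adj).
- apply: down => _; apply: (separated_turn mij tt).
  by rewrite tE; exact: separated_axis_down.
- apply: up => _; apply: (separated_turn mij tt).
  by rewrite tE; exact: separated_axis_up.
have [u su sep] := separated_side m_coxeter ij' mij sk tS t_adj.
(* One step suffices here, so only the values of the function at 0 and 1 matter. *)
apply: (chain (fun n => if n == 0 then v else Real (half_bd i j (~~ b) g u)) 1) => //.
- by lia.
- by move=> [|//] _; split=> //=; apply: (half_edge ij mij).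
- by move=> _; exact: (separated_turn mij tt).
- by exists (half_bd i j (~~ b) g u).
Qed.

End Extension.

Theorem proposition7p5 (r : nat) (m : 'M[option nat]_r)
    (m_coxeter : coxeter_matrix m)
    (m_almost_large : almost_large m)
    (m_nonfree : ~ is_free (artin m))
    (n : nat) (sigma : n.+1.-tuple (set (ho_vertex m)))
    (sigma_geodesic : directed_geodesic (ho_complex m) sigma) :
  exists v : ho_vertex m,
    directed_geodesic (ho_complex m) (rcons (take n sigma) [set v]) /\
    (is_interior v ->
       exists (k : nat) (w : k.-tuple (ho_vertex m)),
         [/\ directed_geodesic (ho_complex m)
               (rcons (take n sigma) [set v] ++ [seq [set x] | x <- w]),
             is_real (last v w) &
             (k <= max_label m - 2)%N]).
Proof.
have sz : (n < size sigma)%N by rewrite size_tuple.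
have sigmaE : tval sigma = rcons (take n sigma) (nth set0 sigma n).
  by rewrite -take_nth // take_oversize // size_tuple.
have [v vn] : nth set0 sigma n !=set0.
  by apply: (@ho_complex_neq0 _ m); case: sigma_geodesic => /(_ n sz).
have dg : directed_geodesic (ho_complex m) (rcons (take n sigma) [set v]).
  apply: directed_geodesic_last_vertex vn; first exact: ho_complex_sub.
  by rewrite -sigmaE.
exists v; split=> // -[i [j [g [s vE]]]]; rewrite vE in dg *.
exact: geodesic_to_real.
Qed.
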